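(* Let $n\ge 1$ and let $\sigma(s)=s^n+\sigma_1 s^{n-1}+\dots+\sigma_{n-1}s+\sigma_n$ be a monic polynomial of degree $n$ with real coefficients that is Hurwitz and has $n$ distinct zeros $-\lambda_1,-\lambda_2,\dots,-\lambda_n\in\mathbb{C}$. For $i\in\{1,\dots,n\}$ and $m\in\{0,1,\dots,n-1\}$ let $\sigma_m^{(i)}$ denote the elementary symmetric polynomial of degree $m$ evaluated at the $n-1$ numbers $\{\lambda_1,\dots,\lambda_n\}\setminus\{\lambda_i\}$. For $k,l\in\{1,\dots,n\}$ set $$r_i(k,l):=\frac{\sigma_{n-k}^{(i)}}{\sigma_{n-l}^{(i)}},\qquad i=1,\dots,n,$$ and let $C(k,l)\in\mathbb{C}^{n\times n}$ be the Hermitian matrix with entries $$C_{ij}(k,l)=\frac{r_i(k,l)+\overline{r_j(k,l)}}{\lambda_i+\overline{\lambda_j}},\qquad i,j=1,\dots,n.$$ Then $C(k,l)$ is positive semidefinite for all $k,l\in\{1,2,\dots,n\}$.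
   Context: A polynomial is Hurwitz if all its zeros have strictly negative real part; hence each $\lambda_i$ has strictly positive real part. The elementary symmetric polynomial of degree $m\ge 1$ in the variables $\{\lambda_1,\dots,\lambda_n\}\setminus\{\lambda_i\}$ is the sum, over all $m$-element subsets $S\subseteq\{1,\dots,n\}\setminus\{i\}$, of $\prod_{j\in S}\lambda_j$; for $m=0$ it equals $1$. The bar denotes complex conjugation. A Hermitian matrix $X\in\mathbb{C}^{n\times n}$ is positive semidefinite if $x^*Xx\ge 0$ for all $x\in\mathbb{C}^n$. *)

(* Defs.v *)
From mathcomp Require Export all_boot all_order all_algebra.
From mathcomp Require Export reals complex.

Set Implicit Arguments.
Unset Strict Implicit.
Unset Printing Implicit Defensive.

Import Order.TTheory GRing.Theory Num.Theory.
Local Open Scope ring_scope.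
Local Open Scope sesquilinear_scope.

Definition complex_poly (R : realType) (p : {poly R}) : {poly R[i]} :=
  map_poly (real_complex R) p.

Definition hurwitz (R : realType) (p : {poly R}) : Prop :=
  forall z : R[i], root (complex_poly p) z -> complex.Re z < 0.

Definition esym_except (R : realType) (n : nat) (lam : 'I_n -> R[i])
    (i : 'I_n) (m : nat) : R[i] :=
  \sum_(S : {set 'I_n} | (S \subset [set~ i]) && (#|S| == m))
    \prod_(j in S) lam j.

(* Meant for 1 <= k, l <= n, so that the truncated n - k and n - l lie in
   {0, ..., n - 1}. *)
Definition ratio (R : realType) (n : nat) (lam : 'I_n -> R[i]) (k l : nat)
    (i : 'I_n) : R[i] :=
  esym_except lam i (n - k) / esym_except lam i (n - l).

Definition Cmx (R : realType) (n : nat) (lam : 'I_n -> R[i]) (k l : nat) :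
    'M[R[i]]_n :=
  \matrix_(i, j) ((ratio lam k l i + (ratio lam k l j)^*)
                  / (lam i + (lam j)^*)).

(* In the order of R[i], 0 <= z means that z is real and nonnegative. *)
Definition psdmx (R : realType) (n : nat) (X : 'M[R[i]]_n) : Prop :=
  X \is hermsymmx /\
  forall x : 'cV[R[i]]_n, 0 <= (x^t* *m X *m x) ord0 ord0.

(* Main.v *)
Require Import Defs.
From mathcomp Require Import all_boot all_order all_algebra.
From mathcomp Require Import ring.
From mathcomp Require Import reals complex.

(* For v in C^n put q(s, z) = \sum_(i, j) v_i v_j^* / (lam_i + lam_j^* )
   * sigma(s) / (s + lam_i) * sigma(z) / (z + lam_j^* ) and
   N(s, z) = q(s, z) + q(z, s). Up to a diagonal congruence, the quadratic form
   of C(k, l) is the coefficient of s^(k-1) z^(l-1) in the real polynomial N.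
   With K(s, t) = q(s, t^* ) / (sigma(s) sigma(t^* )) and
   g(s) = \sum_i v_i / (s + lam_i) one has
     2 Re ((s + t^* ) K(s, t))
       = 2 Re s * K(s, s) + 2 Re t * K(t, t) + |g(s) - g(t)|^2,
   which is positive because the Cauchy matrix (1 / (lam_i + lam_j^* )) is
   positive definite. Hence N has no zero with Re s >= 0 and Re z > 0, and the
   same estimate shows that N(., z) has exact degree n - 1. By Gauss-Lucas every
   coefficient N_a(z) of N(., z) is nonzero for Re z > 0, and a real polynomial
   without zeros in the open right half-plane has all coefficients of one
   sign. *)

Set Implicit Arguments.
Unset Strict Implicit.
Unset Printing Implicit Defensive.

Import Order.TTheory GRing.Theory Num.Theory.
Local Open Scope ring_scope.

(** * Zeros in a half-plane and signs of coefficients *)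

Section HurwitzPolynomials.
Variable C : numClosedFieldType.
Implicit Types (p : {poly C}) (s z : C).

Lemma Re_invC_gt0 z : 0 < 'Re z -> 0 < 'Re z^-1.
Proof.
move=> z_gt0; rewrite invC_norm ReMl ?rpredV ?rpredX ?normr_real// Re_conj.
apply: mulr_gt0 => //; rewrite invr_gt0 exprn_gt0// normr_gt0.
by apply: contraTneq z_gt0 => ->; rewrite raddf0 ltxx.
Qed.

(** The logarithmic derivative is the sum of the 1 / (s - z) over the roots z, and inversion
    preserves the open right half-plane. *)
Lemma Re_logderiv_prod_gt0 (r : seq C) s :
    (forall z, z \in r -> 'Re z < 'Re s) -> (0 < size r)%N ->
  let p := \prod_(z <- r) ('X - z%:P) in 0 < 'Re (p^`().[s] / p.[s]).
Proof.
elim: r => // z [|y r] IH ltr _ /=.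
  rewrite big_seq1 derivXsubC !hornerE ?mul1r Re_invC_gt0// raddfB subr_gt0.
  by rewrite ltr// inE.
rewrite big_cons; set p := \prod_(j <- _) _ in IH *.
have lt_zs : 0 < 'Re (s - z) by rewrite raddfB subr_gt0 ltr// inE eqxx.
have p_gt0 : 0 < 'Re (p^`().[s] / p.[s]).
  by apply: IH => // x xr; rewrite ltr// inE xr orbT.
have ps0 : p.[s] != 0.
  by apply: contraTneq p_gt0 => ->; rewrite invr0 mulr0 raddf0 ltxx.
have sz0 : s - z != 0 by apply: contraTneq lt_zs => ->; rewrite raddf0 ltxx.
rewrite derivM derivXsubC !hornerE.
have -> : (p.[s] + (s - z) * p^`().[s]) / ((s - z) * p.[s]) =
          (s - z)^-1 + p^`().[s] / p.[s] by field; rewrite ps0 sz0.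
by rewrite raddfD addr_gt0 ?Re_invC_gt0.
Qed.

(* The Gauss-Lucas theorem for a half-plane. *)
Lemma Re_logderiv_gt0 p s :
    (1 < size p)%N -> (forall z, root p z -> 'Re z < 'Re s) ->
  0 < 'Re (p^`().[s] / p.[s]).
Proof.
move=> szp ltp; have p0 : p != 0 by rewrite -size_poly_gt0 ltnW.
have [r def_p] := closed_field_poly_normal p.
have l0 : lead_coef p != 0 by rewrite lead_coef_eq0.
move: (szp); rewrite def_p size_scale// size_prod_XsubC => szr.
rewrite derivZ !hornerZ -mulf_div divff// mul1r.
apply: Re_logderiv_prod_gt0 => // z zr.
by apply: ltp; rewrite def_p rootZ// root_prod_XsubC.
Qed.

Lemma deriv_horner_neq0 p s :
    (1 < size p)%N -> (forall z, root p z -> 'Re z < 'Re s) ->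
  p^`().[s] != 0.
Proof.
move=> szp ltp; have := Re_logderiv_gt0 szp ltp; apply: contraTneq => ->.
by rewrite mul0r raddf0 ltxx.
Qed.

Lemma lead_coef_deriv_num p : (1 < size p)%N ->
  size p^`() = (size p).-1 /\
  lead_coef p^`() = lead_coef p *+ (size p).-1.
Proof.
move=> szp; set n := (size p).-2.
have szE : size p = n.+2 by rewrite /n; case: (size p) szp => [|[]].
have p0 : p != 0 by rewrite -size_poly_gt0 ltnW.
have cn : p^`()`_n = lead_coef p *+ n.+1 by rewrite coef_deriv lead_coefE szE.
have szd : size p^`() = n.+1.
  apply/eqP; rewrite eqn_leq -ltnS -szE lt_size_deriv//= ltnNge.
  apply/negP => /leq_sizeP/(_ n (leqnn _))/eqP.
  by rewrite cn mulrn_eq0 lead_coef_eq0 (negPf p0).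
by rewrite szE /= lead_coefE szd cn.
Qed.

Lemma hurwitz_coef_neq0 p a :
  (forall z, root p z -> 'Re z < 0) -> (a < size p)%N -> p`_a != 0.
Proof.
elim: a p => [|a IH] p hp ha.
  rewrite -horner_coef0; apply/negP => /hp; by rewrite raddf0 ltxx.
have szp : (1 < size p)%N by apply: leq_ltn_trans ha.
have [szd _] := lead_coef_deriv_num szp.
have := IH p^`(); rewrite szd ltn_predRL coef_deriv => /(_ _ ha).
rewrite mulrn_eq0 /=; apply=> z; rewrite /root => dz.
have Rz := Creal_Re z; have [//|z_ge0] := real_ltP Rz (real0 _).
suff /negP[] : p^`().[z] != 0 by [].
by apply: deriv_horner_neq0 => // y py; apply: lt_le_trans (hp y py) z_ge0.
Qed.

(* Induction on the degree: p^`() inherits the hypotheses by Gauss-Lucas, and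
   0 < 'Re (p^`() / p) carries positivity on the half-line back to p. *)
Lemma weak_hurwitz_ge0 p :
    p \is a polyOver Num.real -> (forall z, root p z -> 'Re z <= 0) ->
    0 < lead_coef p ->
  (forall a, 0 <= p`_a) /\ (forall s, 0 < s -> 0 < p.[s]).
Proof.
elim: {p}(size p) {-2}p (leqnn (size p)) => [|n IH] p szn Rp hp lp.
  move: szn; rewrite leqn0 size_poly_eq0 => /eqP p0.
  by rewrite p0 lead_coef0 ltxx in lp.
have Rc := polyOverP Rp.
have [sz1|sz1] := leqP (size p) 1.
  have pE := size1_polyC sz1; rewrite pE lead_coefC in lp *; split=> [a|s _].
    by rewrite coefC; case: ifP => // _; apply: ltW.
  by rewrite hornerC.
have [szd ld] := lead_coef_deriv_num sz1.
have [|||d_ge0 d_gt0] := IH p^`() _ (polyOver_deriv Rp).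
- by rewrite szd -ltnS (ltn_predK sz1).
- move=> z dz; have Rz := Creal_Re z; have [//|z_gt0] := real_leP Rz (real0 _).
  suff /negP[] : p^`().[z] != 0 by [].
  by apply: deriv_horner_neq0 => // y py; apply: le_lt_trans (hp y py) z_gt0.
- by rewrite ld pmulrn_lgt0// -ltnS (ltn_predK sz1).
have p_gt0 s : 0 < s -> 0 < p.[s].
  move=> s_gt0; have Rs : s \is Num.real by rewrite gtr0_real.
  have Rps : p.[s] \is Num.real by rewrite rpred_horner.
  have := Re_logderiv_gt0 sz1 (s := s).
  rewrite (Creal_ReP _ Rs) ReMl ?gtr0_real ?d_gt0// pmulr_rgt0 ?d_gt0//.
  rewrite (Creal_ReP _ _) ?rpredV// invr_gt0; apply=> z pz.
  exact: le_lt_trans (hp z pz) s_gt0.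
have cS a : 0 <= p`_a.+1.
  by have := d_ge0 a; rewrite coef_deriv pmulrn_lge0.
split=> // -[|a] //.
(* If p`_0 < 0, then p.[s] < 0 at the explicit small s below. *)
have [//|c0_lt0] := real_leP (real0 _) (Rc 0%N).
pose q := \sum_(1 <= i < size p) p`_i.
have q_ge0 : 0 <= q.
  by rewrite /q big_add1 sumr_ge0.
have sE s : p.[s] = p`_0 + \sum_(1 <= i < size p) p`_i * s ^+ i.
  rewrite horner_coef -(big_mkord xpredT (fun i => p`_i * s ^+ i)).
  by rewrite big_ltn ?(ltnW sz1)// expr0 mulr1.
(* For 0 < s <= 1 one has p(s) <= p_0 + q s. The zero of this bound would be - p_0 / q; subtracting
   p_0 in the denominator puts s below it, keeps s <= 1 and also covers q = 0. *)
pose s := - p`_0 / (q - p`_0).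
have d0 : 0 < q - p`_0 by rewrite ltr_wpDl// oppr_gt0.
have s_gt0 : 0 < s by rewrite divr_gt0// oppr_gt0.
have s_le1 : s <= 1 by rewrite ler_pdivrMr// mul1r ler_wpDl.
have := p_gt0 s s_gt0; rewrite sE => ps.
have : p`_0 + q * s < 0.
  have -> : p`_0 + q * s = - p`_0 ^+ 2 / (q - p`_0).
    by rewrite /s; field; rewrite gt_eqF.
  by rewrite mulNr oppr_lt0 divr_gt0// -sqrrN exprn_gt0// oppr_gt0.
move=> q_lt0; have := fun h => lt_trans ps (le_lt_trans h q_lt0).
rewrite ltxx; apply; rewrite lerD2l /q mulr_suml !big_add1.
apply: ler_sum => i _; rewrite ler_wpM2l// exprS ler_piMr ?(ltW s_gt0)//.
by rewrite exprn_ile1// ltW.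
Qed.

(** The sign of p(1) decides that of the leading coefficient: were the latter negative, - p would be
    positive on the positive half-line. *)
Lemma weak_hurwitz_coef_ge0 p :
    p \is a polyOver Num.real -> (forall z, root p z -> 'Re z <= 0) ->
    0 < p.[1] ->
  forall a, 0 <= p`_a.
Proof.
move=> Rp hp p1_gt0.
have Rl : lead_coef p \is Num.real by rewrite lead_coefE (polyOverP Rp).
have [l_gt0|l_le0] := real_ltP (real0 _) Rl.
  by have [] := weak_hurwitz_ge0 Rp hp l_gt0.
have l_lt0 : 0 < lead_coef (- p).
  rewrite lead_coefN oppr_gt0 lt_neqAle l_le0 andbT lead_coef_eq0.
  by apply: contraTneq p1_gt0 => ->; rewrite horner0 ltxx.
have RNp : - p \is a polyOver Num.real.
  by apply/polyOverP=> a; rewrite coefN realN (polyOverP Rp).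
have hNp z : root (- p) z -> 'Re z <= 0 by rewrite rootN => /hp.
have [_ /(_ 1 ltr01)] := weak_hurwitz_ge0 RNp hNp l_lt0.
by rewrite hornerN oppr_gt0 => /(lt_trans p1_gt0); rewrite ltxx.
Qed.

End HurwitzPolynomials.

(** * Positive definiteness of the Cauchy matrix *)

Section Cauchy.
Variable C : numClosedFieldType.

Lemma Re_gt0_addC_neq0 (x y : C) : 0 < 'Re x -> 0 < 'Re y -> x + y^* != 0.
Proof.
move=> x0 y0; have : 0 < 'Re (x + y^*) by rewrite raddfD /= Re_conj addr_gt0.
by apply: contraTneq => ->; rewrite raddf0 ltxx.
Qed.

Lemma addC_gt0 (x : C) : (0 < x + x^*) = (0 < 'Re x).
Proof. by rewrite ReE pmulr_lgt0// invr_gt0 ltr0n. Qed.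

Definition cauchy_form n (lam v : 'I_n -> C) : C :=
  \sum_i \sum_j v i * (v j)^* / (lam i + (lam j)^*).

(* Induction on n: removing node 0 by a Schur complement leaves the Cauchy form
   of the remaining nodes at the vector w below. *)
Lemma cauchy_form_ge0 n (lam v : 'I_n -> C) :
    (forall i, 0 < 'Re (lam i)) -> injective lam ->
  0 <= cauchy_form lam v /\
  (cauchy_form lam v = 0 -> forall i, v i = 0).
Proof.
elim: n lam v => [|n IH] lam v lam_gt0 lam_inj.
  by rewrite /cauchy_form big_ord0; split=> // _ [].
pose l0 := lam ord0.
pose w i := v i * (lam i - l0) / (lam i + l0^*).
have w0 : w ord0 = 0 by rewrite /w subrr mulr0 mul0r.
pose g := \sum_i v i / (lam i + l0^*).
have neq0 i j : lam i + (lam j)^* != 0 by apply: Re_gt0_addC_neq0.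
have QE : cauchy_form lam v = (l0 + l0^*) * (g * g^*) +
    cauchy_form (lam \o lift ord0) (w \o lift ord0).
  have -> : cauchy_form (lam \o lift ord0) (w \o lift ord0) = cauchy_form lam w.
    rewrite /cauchy_form [RHS]big_ord_recl [X in _ = X + _]big1 ?add0r; last first.
      by move=> i _; rewrite w0 !mul0r.
    apply: eq_bigr => i _; rewrite [RHS]big_ord_recl w0 conjC0 mulr0 mul0r.
    by rewrite add0r.
  rewrite /g rmorph_sum big_distrlr mulr_sumr /= -big_split /=.
  apply: eq_bigr => i _; rewrite mulr_sumr -big_split /=.
  apply: eq_bigr => j _.
  (* Termwise this is (l0 + l0^* ) (lam_i + lam_j^* ) + (lam_i - l0) (lam_j - l0)^* = (lam_i + l0^*
     ) (l0 + lam_j^* ). *)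
  rewrite /w !(rmorphM, rmorphD, rmorphB, fmorphV) /= !conjCK.
  move: (neq0 i j) (neq0 i ord0) (neq0 ord0 j); rewrite -/l0 => h1 h2 h3.
  by field; apply/and3P; split=> //; rewrite addrC.
have l0_gt0 : 0 < l0 + l0^* by rewrite addC_gt0 lam_gt0.
have inj' : injective (lam \o lift ord0).
  by move=> i j /lam_inj /lift_inj.
have [ge0 eq0] := IH (lam \o lift ord0) (w \o lift ord0) (fun i => lam_gt0 _) inj'.
have g_ge0 : 0 <= (l0 + l0^*) * (g * g^*) by rewrite mulr_ge0 ?mul_conjC_ge0// ltW.
rewrite QE; split; first exact: addr_ge0.
move/eqP; rewrite paddr_eq0// => /andP[]; rewrite mulf_eq0 gt_eqF//=.
rewrite mul_conjC_eq0 => /eqP gE /eqP /eq0 wE.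
(* Distinct nodes turn w = 0 into v = 0 away from node 0; then g = 0 reduces to the term of node
   0. *)
have v_lift i : v (lift ord0 i) = 0.
  have /eqP := wE i; rewrite /w /= !mulf_eq0 invr_eq0 (negPf (neq0 _ ord0)) orbF.
  rewrite subr_eq0 => /orP[/eqP//|/eqP /lam_inj] eqi.
  by have := neq_lift ord0 i; rewrite eqi eqxx.
move=> i; case: (unliftP ord0 i) => [j ->//|->].
move: gE; rewrite /g big_ord_recl big1 ?addr0; last first.
  by move=> j _; rewrite v_lift mul0r.
by move/eqP; rewrite mulf_eq0 invr_eq0 (negPf (neq0 _ ord0)) orbF => /eqP.
Qed.

End Cauchy.

(** * Real part estimates for the kernel K *)

Section PickKernel.
Variables (C : numClosedFieldType) (n : nat) (lam v : 'I_n -> C).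
Hypothesis lam_gt0 : forall i, 0 < 'Re (lam i).
Hypothesis lam_inj : injective lam.

Let c i j := v i * (v j)^* / (lam i + (lam j)^*).
Let g s := \sum_i v i / (s + lam i).
Let A s := \sum_i \sum_j c i j / (s + lam i).

Definition pick_kernel (s t : C) : C :=
  \sum_i \sum_j v i * (v j)^* /
    ((lam i + (lam j)^*) * (s + lam i) * (t + lam j)^*).

Lemma addr_lam_neq0 s i : 0 <= 'Re s -> s + lam i != 0.
Proof.
move=> s_ge0; have : 0 < 'Re (s + lam i) by rewrite raddfD ltr_wpDl ?lam_gt0.
by apply: contraTneq => ->; rewrite raddf0 ltxx.
Qed.

Let lamC_neq0 i j : lam i + (lam j)^* != 0.
Proof. exact: Re_gt0_addC_neq0. Qed.

(** Partial fractions: s + t^* = (s + lam_i) + (t + lam_j)^* - (lam_i + lam_j^* ), and each summand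
    cancels one factor of the denominator. *)
Lemma pick_kernelE s t : 0 <= 'Re s -> 0 <= 'Re t ->
  (s + t^*) * pick_kernel s t = A s + (A t)^* - g s * (g t)^*.
Proof.
move=> s_ge0 t_ge0.
have -> : (A t)^* = \sum_i \sum_j c i j / (t + lam j)^*.
  rewrite exchange_big rmorph_sum; apply: eq_bigr => i _; rewrite rmorph_sum.
  apply: eq_bigr => j _; rewrite /c !(rmorphM, fmorphV, rmorphD) /= !conjCK.
  by rewrite [_^* * v j]mulrC [_^* + lam j]addrC.
rewrite /g rmorph_sum big_distrlr /= -big_split -sumrB mulr_sumr /=.
apply: eq_bigr => i _; rewrite -big_split -sumrB mulr_sumr /=.
apply: eq_bigr => j _; rewrite /c fmorph_div.
move: (addr_lam_neq0 i s_ge0) (lamC_neq0 i j).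
have : (t + lam j)^* != 0 by rewrite conjC_eq0 addr_lam_neq0.
rewrite !rmorphD => h1 h2 h3; field.
by apply/and3P; split=> //; rewrite addrC.
Qed.

Lemma pick_kernel_diag s :
  pick_kernel s s = cauchy_form lam (fun i => v i / (s + lam i)).
Proof.
apply: eq_bigr => i _; apply: eq_bigr => j _.
by rewrite fmorph_div !invfM; ring.
Qed.

Hypothesis v_neq0 : exists i, v i != 0.

Let diag_gt0 s : 0 <= 'Re s -> 0 < pick_kernel s s.
Proof.
move=> s_ge0; rewrite pick_kernel_diag.
have [ge0 eq0] := cauchy_form_ge0 (fun i => v i / (s + lam i)) lam_gt0 lam_inj.
rewrite lt_neqAle ge0 andbT eq_sym; apply/eqP => /eq0 v0.
case: v_neq0 => i; have /eqP := v0 i.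
by rewrite mulf_eq0 invr_eq0 (negPf (addr_lam_neq0 _ _))// orbF => ->.
Qed.

Lemma Re_pick_kernel_gt0 s t :
    0 <= 'Re s -> 0 <= 'Re t -> 0 < 'Re s + 'Re t ->
  0 < 'Re ((s + t^*) * pick_kernel s t).
Proof.
move=> s_ge0 t_ge0 st_gt0; rewrite -addC_gt0 pick_kernelE//.
have -> : A s + (A t)^* - g s * (g t)^* + (A s + (A t)^* - g s * (g t)^*)^* =
    (s + s^*) * pick_kernel s s + (t + t^*) * pick_kernel t t +
    (g s - g t) * (g s - g t)^*.
  rewrite !pick_kernelE// !(rmorphB, rmorphD, rmorphM) /= !conjCK; ring.
have addC_ge0 x : 0 <= 'Re x -> 0 <= x + x^*.
  by move=> x_ge0; rewrite -[x + _](divfK (x := 2%:R)) ?pnatr_eq0// -ReE mulr_ge0.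
rewrite ltr_wpDr ?mul_conjC_ge0//.
(* One of s, t lies in the open half-plane, so one of the two diagonal terms is strictly
   positive. *)
have [s_gt0|] := real_ltP (real0 _) (Creal_Re s).
  rewrite ltr_wpDr//; last by rewrite mulr_gt0 ?addC_gt0 ?diag_gt0.
  by rewrite mulr_ge0 ?addC_ge0 ?(ltW (diag_gt0 _)).
move=> s_le0; have t_gt0 : 0 < 'Re t.
  by apply: lt_le_trans st_gt0 _; rewrite gerDr.
rewrite ltr_wpDl//; last by rewrite mulr_gt0 ?addC_gt0 ?diag_gt0.
by rewrite mulr_ge0 ?addC_ge0 ?(ltW (diag_gt0 _)).
Qed.

(** The case t = s of [pick_kernelE] gives 2 Re A(s) = 2 Re s * K(s, s) + |g(s)|^2. As A(s) is the
    limit of t^* K(s, t) for t going to infinity, this controls the leading coefficient of N(.,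
    z). *)
Lemma Re_pick_resolvent_gt0 s : 0 < 'Re s ->
  0 < 'Re (\sum_i \sum_j c i j / (s + lam i)).
Proof.
move=> s_gt0; have s_ge0 := ltW s_gt0; rewrite -addC_gt0 -/(A s).
have -> : A s + (A s)^* = (s + s^*) * pick_kernel s s + g s * (g s)^*.
  by rewrite pick_kernelE// subrK.
by rewrite ltr_wpDr ?mul_conjC_ge0// mulr_gt0 ?addC_gt0 ?diag_gt0.
Qed.

End PickKernel.

(** * The bivariate polynomial N and its coefficients *)

Section BivariateForm.
Variables (C : numClosedFieldType) (n : nat) (lam v : 'I_n -> C).
Hypothesis lam_gt0 : forall i, 0 < 'Re (lam i).
Hypothesis lam_inj : injective lam.

(** This is sigma(s) / (s + lam_i). *)
Definition cofactor_poly (i : 'I_n) : {poly C} :=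
  \prod_(j | j != i) ('X + (lam j)%:P).

Let E := cofactor_poly.
Let Eb i := map_poly Num.conj (E i).
Let S := \prod_j ('X + (lam j)%:P).
Let c i j := v i * (v j)^* / (lam i + (lam j)^*).
Let F s := \sum_i \sum_j c i j / (s + lam i).

Hypothesis S_real : S \is a polyOver Num.real.

Lemma cofactor_polyE i : S = ('X + (lam i)%:P) * E i.
Proof. by rewrite /S (bigD1 i). Qed.

Lemma monic_cofactor_poly i : E i \is monic.
Proof. by apply: monic_prod => j _; rewrite -[_%:P]opprK -polyCN monicXsubC. Qed.

Lemma size_cofactor_poly i : size (E i) = n.
Proof.
rewrite size_prod; last by move=> j _; rewrite -size_poly_gt0 size_XaddC.
under eq_bigr do rewrite size_XaddC.
rewrite sum_nat_const cardC1 card_ord muln2 -addnn subSn ?leq_addr// addnK.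
by rewrite prednK//; apply: leq_trans (ltn_ord i).
Qed.

Lemma root_cofactor_poly i z : root (E i) z -> 'Re z < 0.
Proof.
rewrite /root horner_prod => /prodf_eq0[j _].
rewrite !hornerE addr_eq0 => /eqP ->; by rewrite raddfN oppr_lt0 lam_gt0.
Qed.

(** Used to see that the denominators of the ratios r_i(k, l) do not vanish. *)
Lemma cofactor_poly_coef_neq0 i a : (a < n)%N -> (E i)`_a != 0.
Proof.
move=> an; apply: hurwitz_coef_neq0; last by rewrite size_cofactor_poly.
exact: root_cofactor_poly.
Qed.

Let S_neq0 s : 0 <= 'Re s -> S.[s] != 0.
Proof.
move=> s_ge0; rewrite horner_prod; apply/prodf_neq0 => j _.
by rewrite !hornerE addr_lam_neq0.
Qed.

Let E_horner i s : 0 <= 'Re s -> (E i).[s] = S.[s] / (s + lam i).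
Proof.
move=> s_ge0; rewrite (cofactor_polyE i) !hornerE mulrAC divff ?mul1r//.
exact: addr_lam_neq0.
Qed.

Let map_real (p : {poly C}) : p \is a polyOver Num.real -> map_poly Num.conj p = p.
Proof.
move=> /polyOverP Rp; apply/polyP => a.
by rewrite coef_map /= conj_Creal.
Qed.

(** [Eb j] at s is the conjugate of [E j] at s^*; as sigma is real, conjugating sigma(s^* ) gives
    sigma(s). *)
Let Eb_horner j s : 0 <= 'Re s -> (Eb j).[s] = S.[s] / (s^* + lam j)^*.
Proof.
move=> s_ge0; rewrite -{1}[s]conjCK horner_map /= E_horner ?Re_conj//.
by rewrite fmorph_div /= -[in RHS](map_real S_real) -{3}[s]conjCK horner_map.
Qed.

(** This is N_a, the coefficient of s^a in N(s, z) as a polynomial in z; [P z] below is N(s, z) as a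
    polynomial in s with z fixed. *)
Definition form_coef_poly (a : nat) : {poly C} :=
  \sum_i \sum_j c i j *: ((E i)`_a *: Eb j + (Eb j)`_a *: E i).

Let P z := \sum_i \sum_j c i j *: ((Eb j).[z] *: E i + (E i).[z] *: Eb j).

Let coef_P z a : (P z)`_a = (form_coef_poly a).[z].
Proof.
rewrite /P coef_sum horner_sum; apply: eq_bigr => i _.
rewrite coef_sum horner_sum; apply: eq_bigr => j _.
by rewrite !(coefZ, coefD, hornerZ, hornerD); ring.
Qed.

Lemma form_coef_polyE a b : (form_coef_poly a)`_b =
  \sum_i \sum_j c i j * ((E i)`_a * ((E j)`_b)^* + (E i)`_b * ((E j)`_a)^*).
Proof.
rewrite coef_sum; apply: eq_bigr => i _.
rewrite coef_sum; apply: eq_bigr => j _.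
by rewrite !(coefZ, coefD, coef_map) /=; ring.
Qed.

(** Conjugating a term of the double sum amounts to exchanging i and j. *)
Lemma form_coef_poly_real a : form_coef_poly a \is a polyOver Num.real.
Proof.
apply/polyOverP => b; apply/CrealP; rewrite form_coef_polyE [RHS]exchange_big.
rewrite rmorph_sum; apply: eq_bigr => i _.
rewrite rmorph_sum; apply: eq_bigr => j _.
rewrite /c !(rmorphM, fmorphV, rmorphD) /= !conjCK.
rewrite [_^* + lam j]addrC; ring.
Qed.

Let P_horner z s : 0 <= 'Re z -> 0 <= 'Re s ->
  (P z).[s] = S.[s] * S.[z] *
    (pick_kernel lam v s z^* + pick_kernel lam v z s^*).
Proof.
move=> z_ge0 s_ge0; rewrite /P /pick_kernel horner_sum -big_split mulr_sumr /=.
apply: eq_bigr => i _; rewrite horner_sum -big_split mulr_sumr /=.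
apply: eq_bigr => j _; rewrite !(hornerZ, hornerD) !Eb_horner// !E_horner//.
by rewrite /c !invfM; ring.
Qed.

Hypothesis v_neq0 : exists i, v i != 0.

(** Both kernel values share the multiplier s + z: take t = z^* for the first, and for the second
    swap the roles of s and z. *)
Let kernel_sum_gt0 z s : 0 < 'Re z -> 0 <= 'Re s ->
  0 < 'Re ((s + z) * (pick_kernel lam v s z^* + pick_kernel lam v z s^*)).
Proof.
move=> z_gt0 s_ge0; rewrite mulrDr raddfD addr_gt0//.
  rewrite -{1}[z]conjCK; apply: Re_pick_kernel_gt0 => //.
    by rewrite Re_conj ltW.
  by rewrite Re_conj ltr_wpDl.
rewrite [s + z]addrC -{1}[s]conjCK.
by apply: Re_pick_kernel_gt0; rewrite ?Re_conj ?(ltW z_gt0)// ltr_wpDr.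
Qed.

Let P_neq0 z s : 0 < 'Re z -> 0 <= 'Re s -> (P z).[s] != 0.
Proof.
move=> z_gt0 s_ge0; have z_ge0 := ltW z_gt0.
rewrite P_horner// mulf_neq0 ?mulf_neq0 ?S_neq0//.
have := kernel_sum_gt0 z_gt0 s_ge0; apply: contraTneq => ->.
by rewrite mulr0 raddf0 ltxx.
Qed.

Let P_root z s : 0 < 'Re z -> root (P z) s -> 'Re s < 0.
Proof.
move=> z_gt0 Ps; have [//|s_ge0] := real_ltP (Creal_Re s) (real0 _).
by case/negP: (P_neq0 z_gt0 s_ge0).
Qed.

Let size_P z : 0 < 'Re z -> size (P z) = n.
Proof.
move=> z_gt0; have z_ge0 := ltW z_gt0.
have n_gt0 : (0 < n)%N by case: v_neq0 => i _; apply: leq_trans (ltn_ord i).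
apply/eqP; rewrite eqn_leq; apply/andP; split.
  rewrite (leq_trans (size_sum _ _ _))//; apply/bigmax_leqP => i _.
  rewrite (leq_trans (size_sum _ _ _))//; apply/bigmax_leqP => j _.
  rewrite (leq_trans (size_scale_leq _ _))// (leq_trans (size_polyD _ _))//.
  by rewrite geq_max !(leq_trans (size_scale_leq _ _))//
    ?size_map_poly size_cofactor_poly.
rewrite -(prednK n_gt0) ltnNge; apply/negP => /leq_sizeP/(_ _ (leqnn _)).
have E1 i : (E i)`_n.-1 = 1.
  by rewrite -[X in X.-1](size_cofactor_poly i) -lead_coefE
    (monicP (monic_cofactor_poly i)).
(* The cofactors are monic of degree n - 1, so the top coefficient in s retains only their values at
   z. *)
have -> : (P z)`_n.-1 = S.[z] * (F z + (F z^*)^*).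
  rewrite [(F z^*)^*]rmorph_sum.
  under [X in _ + X]eq_bigr do rewrite rmorph_sum.
  rewrite [X in _ + X]exchange_big -big_split mulr_sumr coef_sum /=.
  apply: eq_bigr => i _; rewrite -big_split mulr_sumr coef_sum /=.
  apply: eq_bigr => j _; rewrite !(coefZ, coefD) coef_map /= !E1 conjC1 !mulr1.
  rewrite Eb_horner// E_horner// /c !(rmorphM, fmorphV, rmorphD) /= !conjCK.
  by rewrite [_^* + lam i]addrC; ring.
move/eqP; apply/negP; rewrite mulf_neq0 ?S_neq0//.
have: 0 < 'Re (F z + (F z^*)^*).
  by rewrite raddfD /= Re_conj addr_gt0 ?Re_pick_resolvent_gt0 ?Re_conj.
by apply: contraTneq => ->; rewrite raddf0 ltxx.
Qed.

Let form_coef_neq0 a z : (a < n)%N -> 0 < 'Re z -> (form_coef_poly a).[z] != 0.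
Proof.
move=> an z_gt0; rewrite -coef_P; apply: hurwitz_coef_neq0; last by rewrite size_P.
by move=> s; apply: P_root.
Qed.

Let Re1 : 'Re (1 : C) = 1.
Proof. by apply/Creal_ReP; rewrite rpred1. Qed.

Let S1_gt0 : 0 < S.[1].
Proof.
have SE : S = \prod_j ('X - (- lam j)%:P).
  by apply: eq_bigr => j _; rewrite polyCN opprK.
have [||_ ->//] := weak_hurwitz_ge0 S_real.
  move=> z.
  rewrite /root horner_prod => /prodf_eq0[j _].
  by rewrite !hornerE addr_eq0 => /eqP ->; rewrite raddfN oppr_le0 ltW ?lam_gt0.
by rewrite SE (monicP _) ?ltr01// monic_prod_XsubC.
Qed.

(** N(1, 1) is sigma(1)^2 times a sum of kernel values. That sum is real because N(1, 1) is, so the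
    bound on its real part gives its sign. *)
Let P1_gt0 : 0 < (P 1).[1].
Proof.
have R1 : (1 : C) \is Num.real by rewrite rpred1.
have RS : S.[1] \is Num.real by rewrite gtr0_real.
have := @kernel_sum_gt0 1 1; rewrite Re1 => /(_ ltr01 ler01).
have RP : (P 1).[1] \is Num.real.
  rewrite rpred_horner//; apply/polyOverP => a.
  by rewrite coef_P rpred_horner ?form_coef_poly_real.
move: (RP); rewrite P_horner ?Re1// => RK.
set K := _ + pick_kernel _ _ _ _ in RK *.
have {}RK : K \is Num.real.
  have -> : K = (S.[1] * S.[1])^-1 * (S.[1] * S.[1] * K).
    by rewrite mulKf// mulf_neq0// gt_eqF.
  by rewrite rpredM// rpredV rpredM.
have R2 : (1 + 1 : C) \is Num.real by rewrite rpredD.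
rewrite (Creal_ReP _ _) ?rpredM// (pmulr_rgt0 _ (addr_gt0 ltr01 ltr01)) => K_gt0.
by rewrite pmulr_rgt0 ?mulr_gt0.
Qed.

(** The sign criterion is used twice: on N(., 1), where N(1, 1) > 0 yields N_a(1) >= 0, and then on
    N_a, whose value at 1 is also nonzero. *)
Lemma form_coef_ge0 a b : (a < n)%N -> 0 <= (form_coef_poly a)`_b.
Proof.
move=> an; apply: weak_hurwitz_coef_ge0 => [|z|]; first exact: form_coef_poly_real.
  move=> Nz; have [//|z_gt0] := real_leP (Creal_Re z) (real0 _).
  by case/negP: (form_coef_neq0 an z_gt0).
rewrite lt_neqAle eq_sym form_coef_neq0 ?Re1//= -coef_P.
apply: weak_hurwitz_coef_ge0 => // [|s]; last first.
  by move=> Ps; apply: ltW; apply: P_root Ps; rewrite Re1.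
apply/polyOverP => d; by rewrite coef_P rpred_horner ?form_coef_poly_real ?rpred1.
Qed.

End BivariateForm.

(** * Cofactor coefficients as elementary symmetric sums *)

Lemma cofactor_poly_coef (C : numClosedFieldType) n (lam : 'I_n -> C) i a :
    (a < n)%N ->
  (cofactor_poly lam i)`_a =
    \sum_(J : {set 'I_n} | (J \subset [set~ i]) && (#|J| == n.-1 - a)%N)
      \prod_(j in J) lam j.
Proof.
move=> an.
(* The values 0 and 1 at i make the missing factor equal to 1 and kill every subset J containing i
   when the product is expanded. *)
pose f j : {poly C} := if j != i then (lam j)%:P else 0.
pose g j : {poly C} := if j != i then 'X else 1.
have -> : cofactor_poly lam i = \prod_j (f j + g j).
  rewrite /cofactor_poly big_mkcond; apply: eq_bigr => j _; rewrite /f /g.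
  by case: ifP; rewrite ?add0r// addrC.
rewrite bigA_distr coef_sum [RHS]big_mkcond; apply: eq_bigr => J _.
have [sJ|] := boolP (J \subset [set~ i]); last first.
  rewrite subsetC sub1set inE negbK => iJ.
  by rewrite (bigD1 i)//= iJ /f eqxx mul0r coef0.
have iJ : i \notin J by move: sJ; rewrite subsetC sub1set inE.
have fJ j : j \in J -> f j = (lam j)%:P.
  by move=> jJ; rewrite /f; case: eqP => // ji; rewrite -ji jJ in iJ.
rewrite (bigID (mem J))/= [X in _ * X](bigD1 i)//= (negPf iJ) /g eqxx mul1r.
rewrite (eq_bigr (fun j => (lam j)%:P)); last by move=> j jJ; rewrite jJ fJ.
rewrite -rmorph_prod coefCM [X in _ * (polyseq X)`_a](eq_bigr (fun _ => 'X)); last first.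
  by move=> j /andP[/negPf -> ->].
rewrite prodr_const coefXn.
have -> : #|[pred j | (j \notin J) && (j != i)]| = (n.-1 - #|J|)%N.
  have cJ : (#|J| + #|~: (i |: J)|)%N = n.-1.
    have := cardsC (i |: J); rewrite card_ord cardsU1 iJ.
    exact: (congr1 predn).
  rewrite -cJ addKn; apply: eq_card => j.
  by rewrite !inE negb_or andbC.
have leJ : (#|J| <= n.-1)%N.
  by have := subset_leq_card sJ; rewrite cardsC1 card_ord.
have an1 : (a <= n.-1)%N by rewrite -ltnS (ltn_predK an).
rewrite eq_sym -(eqn_add2r #|J|) subnK// -{1}(subnKC an1) eqn_add2l eq_sym.
by case: eqP; rewrite ?mulr1 ?mulr0.
Qed.

(** * Reduction of the quadratic form to a coefficient of N *)

Theorem theorem1 (R : realType) (n : nat) (hn : (1 <= n)%N)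
    (sigma : {poly R}) (sigma_monic : sigma \is monic)
    (sigma_size : size sigma = n.+1) (sigma_hurwitz : hurwitz sigma)
    (lam : 'I_n -> R[i]) (lam_inj : injective lam)
    (lam_root : forall i : 'I_n, root (complex_poly sigma) (- lam i)) :
  forall k l : nat, (1 <= k <= n)%N -> (1 <= l <= n)%N ->
    psdmx (Cmx lam k l).
Proof.
move=> k l /andP[k_gt0 kn] /andP[l_gt0 ln].
have lam_gt0 i : 0 < 'Re (lam i).
  have := sigma_hurwitz _ (lam_root i).
  by rewrite raddfN oppr_lt0 -complexRe ltcR.
have S_real : \prod_j ('X + (lam j)%:P) \is a polyOver Num.real.
  have -> : \prod_j ('X + (lam j)%:P) = complex_poly sigma.
    rewrite (@all_roots_prod_XsubC _ (complex_poly sigma) [seq - lam i | i <- enum 'I_n]).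
    - rewrite lead_coef_map (monicP sigma_monic) rmorph1 scale1r big_map.
      rewrite big_enum; apply: eq_bigr => j _.
      by rewrite polyCN opprK.
    - by rewrite size_map_poly sigma_size size_map size_enum_ord.
    - by apply/allP => _ /mapP[j _ ->].
    - rewrite uniq_rootsE map_inj_uniq ?enum_uniq//.
      by move=> i j /oppr_inj /lam_inj.
  apply/polyOverP => a; rewrite coef_map /=.
  by apply/Creal_ReP; rewrite -complexRe.
(* The cofactor has degree n - 1, so symmetric degree n - m sits at exponent m - 1. *)
have esymE i m : (0 < m <= n)%N ->
    esym_except lam i (n - m) = (cofactor_poly lam i)`_m.-1.
  case: m => // m /= mn; rewrite cofactor_poly_coef//.
  by rewrite -subn1 -subnDA add1n.
have esym_neq0 i m : (0 < m <= n)%N -> esym_except lam i (n - m) != 0.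
  move=> mn; rewrite esymE//; apply: cofactor_poly_coef_neq0 => //.
  by case: m mn.
split.
  apply/is_hermitianmxP; rewrite expr0 scale1r; apply/matrixP => i j.
  rewrite !mxE !(rmorphM, fmorphV, rmorphD) /= !conjCK.
  by rewrite addrC [lam i + _]addrC.
(* The diagonal congruence: dividing by the denominator of r_i turns the symmetrised products of
   coefficients into r_i + r_j^*. *)
move=> x; pose v i := (x i ord0)^* / esym_except lam i (n - l).
rewrite [leRHS](_ : _ = (form_coef_poly lam v k.-1)`_l.-1); last first.
  rewrite mxE form_coef_polyE exchange_big; apply: eq_bigr => j _.
  rewrite mxE mulr_suml; apply: eq_bigr => i _.
  rewrite !mxE -!esymE ?k_gt0 ?l_gt0// /v /Defs.ratio.
  have := esym_neq0 i l; have := esym_neq0 j l; rewrite l_gt0 ln.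
  rewrite -(conjC_eq0 (esym_except lam j _)).
  have := @Re_gt0_addC_neq0 _ _ _ (lam_gt0 i) (lam_gt0 j).
  rewrite !fmorph_div /= !conjCK.
  move: (esym_except lam i _) (esym_except lam i _) => a b.
  move: ((esym_except lam j _)^*) ((esym_except lam j _)^*) => a' b'.
  move=> h1 /(_ isT) h2 /(_ isT) h3; field.
  by apply/and3P; split.
(* The positivity argument requires v to be nonzero; for v = 0 the form vanishes. *)
have [/forallP v0|] := boolP [forall i, v i == 0].
  rewrite form_coef_polyE big1// => i _; rewrite big1// => j _.
  by rewrite (eqP (v0 i)) !mul0r.
rewrite negb_forall => /existsP v_neq0.
by apply: form_coef_ge0 => //; case: k k_gt0 kn {esymE}.
Qed.
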